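(* Let $a, b > 0$ be real numbers and for $t \ge 0$ define $$f(t) := \max_{\lambda < 0} \min\left\{ \frac{a}{|\lambda|} + e^{t\lambda},\ \frac{|\lambda|}{b} + 1 - e^{t\lambda} \right\}.$$ Then $$t^* := \frac{\ln 2}{\sqrt{ab}}$$ is the minimizer of $f(t)$ over $t \ge 0$. *)

(* Defs.v *)
From mathcomp Require Import all_boot all_order all_algebra.
From mathcomp Require Import all_classical all_reals all_analysis.
Set Implicit Arguments.
Unset Strict Implicit.
Unset Printing Implicit Defensive.
Import Order.TTheory GRing.Theory Num.Theory.
Local Open Scope classical_set_scope.
Local Open Scope ring_scope.

Definition is_maximum (R : realType) (A : set R) (m : R) : Prop :=
  A m /\ ubound A m.

Definition is_minimizer (R : realType) (D : set R) (F : R -> R) (x : R) : Prop :=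
  D x /\ forall y, D y -> F x <= F y.

Definition objective (R : realType) (a b t lam : R) : R :=
  Num.min (a / `|lam| + expR (t * lam)) (`|lam| / b + 1 - expR (t * lam)).

Definition objective_values (R : realType) (a b t : R) : set R :=
  [set objective a b t lam | lam in [set lam | lam < 0]].

(* [sup] is the maximum only when the latter exists, i.e. when
   [is_maximum (objective_values a b t) (f a b t)] holds; for a set without
   supremum, [sup] is the junk value 0. *)
Definition f (R : realType) (a b t : R) : R := sup (objective_values a b t).

(* Main.v *)
Require Import Defs.
From mathcomp Require Import all_boot all_order all_algebra.
From mathcomp Require Import all_classical all_reals all_analysis.
From mathcomp Require Import ring lra.
Import Order.TTheory GRing.Theory Num.Theory.
Import numFieldNormedType.Exports.
Local Open Scope classical_set_scope.
Local Open Scope ring_scope.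

Set Implicit Arguments.
Unset Strict Implicit.

(** Write [x = |lam|] and [e = exp (- t x)]. The first branch decreases in [x],
the second increases, so the maximum of their minimum is their common value at
a crossing point [x]. There, this value is half the sum of the branches,
[(a / x + x / b + 1) / 2], which no longer involves [e]. By AM-GM it is at
least [sqrt (a / b) + 1 / 2], with equality exactly when [x = sqrt (a b)], and
the branches cross at this point exactly when [e = 1 / 2]. *)

Lemma is_maximum_sup (R : realType) (A : set R) (m : R) :
  is_maximum A m -> sup A = m.
Proof.
move=> [Am mub]; apply/eqP; rewrite eq_le ge_sup//; last by exists m.
by rewrite ub_le_sup//; exists m.
Qed.

Definition crossing (R : realType) (a b t x : R) : Prop :=
  a / x + expR (- (t * x)) = x / b + 1 - expR (- (t * x)).

Section Crossing.
Variables (R : realType) (a b : R).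
Hypotheses (a_gt0 : 0 < a) (b_gt0 : 0 < b).

Lemma objectiveN (t x : R) : 0 < x ->
  objective a b t (- x) =
  Num.min (a / x + expR (- (t * x))) (x / b + 1 - expR (- (t * x))).
Proof. by move=> x0; rewrite /objective normrN gtr0_norm// mulrN. Qed.

Lemma crossing_exists (t : R) : 0 <= t -> exists2 x, 0 < x & crossing a b t x.
Proof.
move=> t0.
(* [p] is [x] times the second branch minus the first. The factor [x] clears the pole of [a / x], so
   [p] is continuous on all of [R] and the interval can start at 0. *)
pose p (x : R) := x * (x / b + 1 - (expR (- (t * x)) + expR (- (t * x)))) - a.
have pc : continuous p.
  have ec : continuous (fun x : R => expR (- (t * x))).
    move=> x; apply: continuous_comp; last exact: continuous_expR.
    by apply: cvgN; apply: cvgM; [exact: cvg_cst|exact: cvg_id].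
  move=> x; apply: cvgB; last exact: cvg_cst.
  apply: cvgM; first exact: cvg_id.
  apply: cvgB; last by apply: cvgD; exact: ec.
  apply: cvgD; last exact: cvg_cst.
  by apply: cvgM; [exact: cvg_id|exact: cvg_cst].
have p0 : p 0 <= 0 by rewrite /p mul0r sub0r oppr_le0 ltW.
have ab0 : 0 <= a + b by rewrite addr_ge0// ltW.
(* At [a + b] the term [x * (x / b)] already exceeds [a], and the rest is nonnegative because the
   exponential is at most 1 for [t >= 0]. *)
have pM : 0 <= p (a + b).
  have e1 : expR (- (t * (a + b))) <= 1.
    by rewrite expR_le1 oppr_le0 mulr_ge0.
  rewrite /p; move: (expR _) e1 => e e1.
  have -> : (a + b) * ((a + b) / b + 1 - (e + e)) - a =
      a * (a / b) + (a + b) * (2 - (e + e)).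
    by field; rewrite gt_eqF.
  have e2 : 0 <= 2 - (e + e) by lra.
  by apply: addr_ge0; apply: mulr_ge0; rewrite // ?divr_ge0// ltW.
have [|x /andP[x0 _] px] := IVT ab0 (v := 0) (continuous_subspaceT pc).
  by rewrite ge_min p0 le_max pM orbT.
(* The root is not the endpoint 0, since [p 0 = - a] is nonzero. *)
have {x0}x_gt0 : 0 < x.
  rewrite lt_neqAle; apply/andP; split; last by move: x0; rewrite bnd_simp.
  apply/eqP => xE; move: px; rewrite -xE /p mul0r sub0r => /eqP.
  by rewrite oppr_eq0 gt_eqF.
exists x => //; rewrite /crossing; move/eqP: px; rewrite /p subr_eq add0r => /eqP.
set e := expR _ => px; rewrite -px.
by field; rewrite !gt_eqF.
Qed.

Lemma crossing_maximum (t x : R) : 0 <= t -> 0 < x -> crossing a b t x ->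
  is_maximum (objective_values a b t) (a / x + expR (- (t * x))).
Proof.
move=> t0 x0 xc; split.
  exists (- x); first by rewrite /= oppr_lt0.
  by rewrite objectiveN// -xc minxx.
move=> _ [l /= l0 <-].
have y0 : 0 < - l by rewrite oppr_gt0.
(* Bounding one branch suffices: the decreasing one to the right of the crossing, the increasing one
   to its left. *)
rewrite -[l]opprK objectiveN// ge_min.
move: (- l) y0 => y y0.
have [xy|yx] := leP x y; apply/orP; [left|right].
  apply: lerD; first by rewrite ler_pM2l// lef_pV2.
  by rewrite ler_expR lerN2 ler_wpM2l.
rewrite xc; apply: lerB.
  by rewrite lerD2r ler_pM2r ?invr_gt0// ltW.
by rewrite ler_expR lerN2 ler_wpM2l// ltW.
Qed.

Lemma f_crossing (t x : R) : 0 <= t -> 0 < x -> crossing a b t x ->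
  f a b t = (a / x + x / b + 1) / 2.
Proof.
move=> t0 x0 xc; rewrite /f (is_maximum_sup (crossing_maximum t0 x0 xc)).
by move: xc; rewrite /crossing; lra.
Qed.

(** AM-GM with its exact defect, obtained by writing [a] as [s ^+ 2 / b] with
    [s = Num.sqrt (a * b)]. The square gives both the lower bound and the equality case. *)
Lemma f_crossing_sqrt (t x : R) : 0 <= t -> 0 < x -> crossing a b t x ->
  f a b t = Num.sqrt (a * b) / b + 1 / 2 +
            (x - Num.sqrt (a * b)) ^+ 2 / (2 * b * x).
Proof.
move=> t0 x0 xc; rewrite (f_crossing t0 x0 xc).
have := sqr_sqrtr (ltW (mulr_gt0 a_gt0 b_gt0)).
move: (Num.sqrt _) => s sE.
have -> : a = s ^+ 2 / b by rewrite sE mulfK// gt_eqF.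
by field; rewrite !gt_eqF.
Qed.

Lemma crossing_sqrtE (t : R) :
  crossing a b t (Num.sqrt (a * b)) <-> t = ln 2 / Num.sqrt (a * b).
Proof.
have ab0 := mulr_gt0 a_gt0 b_gt0.
have s0 : 0 < Num.sqrt (a * b) by rewrite sqrtr_gt0.
have sE := sqr_sqrtr (ltW ab0).
rewrite /crossing; move: (Num.sqrt _) s0 sE => s s0 sE.
(* The rational terms cancel at [s], leaving only [expR (- (t * s)) = 1 / 2]. *)
have -> : a / s = s / b.
  have -> : a = s ^+ 2 / b by rewrite sE mulfK// gt_eqF.
  by field; rewrite !gt_eqF.
have e2 : expR (- ln 2) = 2^-1 :> R by rewrite expRN lnK// posrE.
split=> [h|->]; last first.
  by rewrite divfK ?gt_eqF// e2; lra.
have /expR_inj/oppr_inj <- : expR (- (t * s)) = expR (- ln 2).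
  by rewrite e2; lra.
by rewrite mulfK// gt_eqF.
Qed.

End Crossing.

Unset Implicit Arguments.
Set Strict Implicit.

Theorem mainTheorem5 (R : realType) (a b : R) (ha : 0 < a) (hb : 0 < b) :
  (forall t : R, 0 <= t -> is_maximum (objective_values a b t) (f a b t)) /\
  (forall t : R,
     is_minimizer [set s : R | 0 <= s] (f a b) t <->
     t = ln 2 / Num.sqrt (a * b)).
Proof.
split=> [t t0|t].
  have [x x0 xc] := crossing_exists ha hb t0.
  have m := crossing_maximum ha hb t0 x0 xc.
  by rewrite /f (is_maximum_sup m).
have s0 : 0 < Num.sqrt (a * b) by rewrite sqrtr_gt0 mulr_gt0.
pose ts := ln 2 / Num.sqrt (a * b).
have ts0 : 0 <= ts by rewrite divr_ge0 ?ln_ge0 ?ler1n// ltW.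
have fts : f a b ts = Num.sqrt (a * b) / b + 1 / 2.
  rewrite (f_crossing_sqrt ha hb ts0 s0) ?subrr ?expr0n ?mul0r ?addr0//.
  exact/(crossing_sqrtE ha hb).
split=> [[/= t0 tmin]|->]; last first.
  split=> //= y y0; rewrite -/ts fts.
  have [x x0 xc] := crossing_exists ha hb y0.
  rewrite (f_crossing_sqrt ha hb y0 x0 xc) lerDl.
  by rewrite divr_ge0 ?sqr_ge0// !mulr_ge0// ltW.
(* Uniqueness: comparing a minimizer [t] with [ts] forces the square in [f_crossing_sqrt] to vanish,
   so its crossing is at [Num.sqrt (a * b)], which determines [t]. *)
have [x x0 xc] := crossing_exists ha hb t0.
apply/(crossing_sqrtE ha hb).
suff <- : x = Num.sqrt (a * b) by [].
have := tmin _ ts0.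
rewrite fts (f_crossing_sqrt ha hb t0 x0 xc) gerDl.
rewrite pmulr_lle0 ?invr_gt0 ?mulr_gt0//.
by rewrite le_eqVlt ltNge sqr_ge0 orbF sqrf_eq0 subr_eq0 => /eqP.
Qed.
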